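(* Let $\Gamma$ be a countable amenable group with a fixed Følner sequence $\{F_n\}_{n\ge1}$, let $\pi\colon X\to Y$ be a factor map between dynamical systems of $\Gamma$, let $\Gamma\curvearrowright G$ be a dynamical system, and suppose that $X$ is a $G$-extension of $Y$ (via $\pi$). Then $\operatorname{mdim}(G)=\operatorname{mdim}(\pi^{-1}(y),\Gamma)$ for every $y\in Y$.
   Context: $\Gamma$ is a countable amenable group and $\mathcal F(\Gamma)$ is the set of nonempty finite subsets of $\Gamma$. For $K\in\mathcal F(\Gamma)$ and $\delta>0$, $\mathcal B(K,\delta)$ is the set of $F\in\mathcal F(\Gamma)$ with $|\{t\in F: Kt\subseteq F\}|\ge(1-\delta)|F|$. For a real-valued $\varphi$ on $\mathcal F(\Gamma)$, $\lim_F\varphi(F)=c$ means: for every $\varepsilon>0$ there are $K\in\mathcal F(\Gamma)$, $\delta>0$ with $|\varphi(F)-c|<\varepsilon$ for all $F\in\mathcal B(K,\delta)$. A Følner sequence is a sequence $\{F_n\}_{n\ge1}$ in $\mathcal F(\Gamma)$ with $|sF_n\Delta F_n|/|F_n|\to0$ for every $s\in\Gamma$. A dynamical system $\Gamma\curvearrowright X$ is a (nonempty) compact metrizable space $X$ with a continuous action of $\Gamma$. A factor map $\pi\colon X\to Y$ is a continuous $\Gamma$-equivariant surjection. $G$-extension: given a factor map $\pi\colon X\to Y$ and a dynamical system $\Gamma\curvearrowright G$ ($G$ is not required to be a group), $X$ is a $G$-extension of $Y$ if there is a continuous map $X\times G\to X$, $(x,g)\mapsto xg$, such that for all $x\in X$,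 $g,g'\in G$, $t\in\Gamma$: (1) $\pi^{-1}(\pi(x))=xG$; (2) $xg=xg'$ exactly when $g=g'$; (3) $t(xg)=(tx)(tg)$. For a finite open cover $\mathcal U$ of a space $X$, $\operatorname{ord}(\mathcal U)=\max_{x\in X}\sum_{U\in\mathcal U}1_U(x)-1$; $\mathcal U$ refines $\mathcal V$ if every element of $\mathcal U$ is contained in some element of $\mathcal V$; $\mathcal D(\mathcal U)$ is the minimum of $\operatorname{ord}(\mathcal W)$ over all finite open covers $\mathcal W$ of the space refining $\mathcal U$. For a dynamical system and $F\in\mathcal F(\Gamma)$, $\mathcal U^F=\bigvee_{s\in F}s^{-1}\mathcal U$, where $\mathcal U\vee\mathcal V=\{U\cap V:U\in\mathcal U,V\in\mathcal V\}$. The mean dimension of $\Gamma\curvearrowright G$ is $\operatorname{mdim}(G)=\sup_{\mathcal U}\lim_F\mathcal D(\mathcal U^F)/|F|\in[0,\infty]$ over all finite open covers $\mathcal U$ of $G$ (the limit exists). For a closed subset $K\subseteq X$, $\mathcal U|_K=\{U\cap K:U\in\mathcal U\}$ is the induced open cover of $K$, and $$\operatorname{mdim}(K,\Gamma)=\sup_{\mathcal U}\liminf_{n\to\infty}\frac{\mathcal D(\mathcal U^{F_n}|_K)}{|F_n|},$$ where $\mathcal U$ ranges over all finite open covers of $X$. *)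

(* Defs.v *)
From HB Require Import structures.
From mathcomp Require Import all_boot all_order all_algebra finmap.
From mathcomp Require Import all_classical all_reals all_analysis.

Set Implicit Arguments.
Unset Strict Implicit.
Unset Printing Implicit Defensive.

Import Order.TTheory GRing.Theory Num.Theory.
Import numFieldNormedType.Exports.

Local Open Scope classical_set_scope.
Local Open Scope ring_scope.

Definition ltransl (Γ : groupType) (s : Γ) (F : {fset Γ}) : {fset Γ} :=
  [fset (s * t)%g | t in F]%fset.

Definition rtransl (Γ : groupType) (K : {fset Γ}) (t : Γ) : {fset Γ} :=
  [fset (k * t)%g | k in K]%fset.

Definition almost_inv (R : realType) (Γ : groupType) (K : {fset Γ}) (δ : R) :
    set {fset Γ} :=
  [set F | F != fset0 /\
    (1 - δ) * #|` F|%:R <=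
      #|` [fset t in F | (rtransl K t `<=` F)%fset]%fset|%:R].

(* Convergence of [phi] to [c] along this filter is, unfolded,
   [forall e > 0, exists K != fset0, exists δ > 0, forall F in
   almost_inv K δ, `|phi F - c| < e]. *)
Definition folner_filter (R : realType) (Γ : groupType) : set_system {fset Γ} :=
  filter_from [set Kδ : {fset Γ} * R | Kδ.1 != fset0 /\ 0 < Kδ.2]
    (fun Kδ => almost_inv Kδ.1 Kδ.2).
Arguments folner_filter R Γ : clear implicits.

Definition amenable (R : realType) (Γ : groupType) : Prop :=
  forall (K : {fset Γ}) (δ : R), K != fset0 -> 0 < δ ->
    almost_inv K δ !=set0.

Definition folner_sequence (R : realType) (Γ : groupType)
    (F : nat -> {fset Γ}) : Prop :=
  (forall n, F n != fset0) /\
  forall s : Γ,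
    (#|` ((ltransl s (F n) `\` F n) `|` (F n `\` ltransl s (F n)))%fset|%:R
       / #|` F n|%:R : R) @[n --> \oo] --> (0 : R).

Definition metrizable (R : realType) (T : topologicalType) : Prop :=
  exists d : T -> T -> R,
    [/\ forall x y, d x y = 0 <-> x = y,
        forall x y, d x y = d y x,
        forall x y z, d x z <= d x y + d y z &
        forall x : T, nbhs x =
          filter_from [set e : R | 0 < e] (fun e => [set y | d x y < e])].

(* [Γ] is discrete, so continuity of the action is continuity of each of the
   maps [act s]. *)
Record dynamical_system (R : realType) (Γ : groupType) (X : topologicalType)
    (act : Γ -> X -> X) : Prop := DynamicalSystem {
  ds_nonempty : [set: X] !=set0 ;
  ds_compact : compact [set: X] ;
  ds_metrizable : metrizable R X ;
  ds_act1 : forall x, act 1%g x = x ;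
  ds_actM : forall s t x, act (s * t)%g x = act s (act t x) ;
  ds_continuous : forall s, continuous (act s) }.

Definition factor_map (Γ : groupType) (X Y : topologicalType)
    (actX : Γ -> X -> X) (actY : Γ -> Y -> Y) (π : X -> Y) : Prop :=
  [/\ continuous π,
      forall s x, π (actX s x) = actY s (π x) &
      set_surj [set: X] [set: Y] π].

Definition G_extension (Γ : groupType) (X Y G : topologicalType)
    (actX : Γ -> X -> X) (actG : Γ -> G -> G) (π : X -> Y) : Prop :=
  exists m : X -> G -> X,
    [/\ continuous (fun p : X * G => m p.1 p.2),
        forall x, π @^-1` [set π x] = range (m x),
        forall x g g', m x g = m x g' <-> g = g' &
        forall t x g, actX t (m x g) = m (actX t x) (actG t g)].

Definition fin_open_cover (T : topologicalType) (U : {fset set T}) : Prop :=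
  (forall A, A \in U -> open A) /\ forall x : T, exists2 A, A \in U & A x.

Definition refines (T : Type) (U V : {fset set T}) : Prop :=
  forall A, A \in U -> exists2 B, B \in V & A `<=` B.

(* The supremum of a nonempty bounded set of natural numbers is its maximum,
   and the truncated subtraction is exact when [U] covers a nonempty space. *)
Definition cover_ord (T : Type) (U : {fset set T}) : nat :=
  (supremum 0 (range (fun x : T => (\sum_(A <- U) (x \in A))%N)) - 1)%N.

(* The infimum of a nonempty set of natural numbers is its minimum. *)
Definition cover_D (T : topologicalType) (U : {fset set T}) : nat :=
  infimum 0%N [set cover_ord W | W in
    [set W : {fset set T} | fin_open_cover W /\ refines W U]].

Definition cover_join (T : Type) (U V : {fset set T}) : {fset set T} :=
  [fset (A `&` B)%classic | A in U, B in V]%fset.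

Definition cover_preimage (S T : Type) (f : S -> T) (U : {fset set T}) :
    {fset set S} :=
  [fset (f @^-1` A)%classic | A in U]%fset.

(* [s^-1 A] is the preimage of [A] under [act s]; the cover [{T}] is neutral
   for [cover_join]. *)
Definition cover_dyn (Γ : groupType) (T : Type) (act : Γ -> T -> T)
    (U : {fset set T}) (F : {fset Γ}) : {fset set T} :=
  \big[@cover_join T/[fset setT]%fset]_(s <- F) cover_preimage (act s) U.

(* A cover of the subspace [K], where [K] is seen as a type with the subspace
   topology and [set_val] is its inclusion. *)
Definition cover_restr (T : Type) (K : set T) (U : {fset set T}) :
    {fset set K} :=
  cover_preimage (@set_val T K) U.

Definition mdim (R : realType) (Γ : groupType) (T : topologicalType)
    (act : Γ -> T -> T) : \bar R :=
  ereal_sup [set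
    (lim (((cover_D (cover_dyn act U F))%:R / #|` F|%:R : R)
            @[F --> folner_filter R Γ]))%:E
    | U in @fin_open_cover T].

Definition mdim_subset (R : realType) (Γ : groupType) (F : nat -> {fset Γ})
    (T : topologicalType) (act : Γ -> T -> T) (K : set T) : \bar R :=
  ereal_sup [set
    limn_einf (fun n =>
      ((cover_D (cover_restr K (cover_dyn act U (F n))))%:R
         / #|` F n|%:R)%:E)
    | U in @fin_open_cover T].

(* Main.v *)
Require Import Defs.
From HB Require Import structures.
From mathcomp Require Import all_boot all_order all_algebra finmap.
From mathcomp Require Import all_classical all_reals all_analysis.
From mathcomp Require Import ring lra.

Set Implicit Arguments.
Unset Strict Implicit.
Unset Printing Implicit Defensive.

Import Order.TTheory GRing.Theory Num.Theory.
Import numFieldNormedType.Exports.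

Local Open Scope classical_set_scope.

(* For [x] in the fibre, [m x] is a homeomorphism from [G] onto the fibre, and
   [t (m x g) = m (t x) (t g)]: it is not equivariant, but since [m] and the
   inverses of the maps [m z] are equicontinuous uniformly in [z], every finite
   open cover of [X] can be compared with one of [G] along all the maps [m z] at
   once, and conversely. Hence D(V^F) and D(U^F|_fibre) bound each other for
   every finite set [F], and it remains to see that the limit defining mdim(G)
   exists, so that it can be computed along the given Folner sequence.

   This limit exists because F |-> D(V^F) is subadditive and right-invariant
   (Ornstein-Weiss). Let α be the infimum of the [a] such that h(F) <= a|F| for
   all sufficiently invariant F, and suppose that arbitrarily invariant [K] have
   h(K) <= b|K| with b < α. A maximal almost disjoint family of translates of such
   a [K] inside [F] has a union [A] containing a definite proportion of [F], with
   h(A) at most about b|A|, and F \ A is either negligible or still invariant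
   enough to have h(F \ A) <= a|F \ A| with [a] close to α; then h(F) <= a'|F|
   with a' < α, a contradiction. Only one scale of tiles is used at a time.

   Subadditivity of D under joins: partitions of unity subordinate to two covers
   give two subdivisions of [0,1] into consecutive intervals; the lengths of the
   pairwise overlaps depend continuously on the point, and subdivisions into [a]
   and [b] nondegenerate intervals have at most a + b - 1 overlaps. *)

Lemma card_fset_sum (T : choiceType) (A : {fset T}) (P : pred T) :
  #|` [fset t in A | P t]%fset| = (\sum_(t <- A) P t)%N.
Proof. by rewrite card_fset_sum1 -big_fset_condE big_mkcond. Qed.

(** * The Ornstein-Weiss lemma *)

Section OrnsteinWeiss.
Context {R : realType} {Γ : groupType}.
Implicit Types (K F A B C : {fset Γ}) (k t c : Γ).
Local Open Scope fset_scope.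
Local Open Scope ring_scope.

Lemma card_fset_predC A (P : pred Γ) :
  (#|` [fset t in A | P t]| + #|` [fset t in A | ~~ P t]| = #|` A|)%N.
Proof.
rewrite !card_fset_sum -big_split card_fset_sum1 /=.
by apply: eq_bigr => t _; case: (P t).
Qed.

Lemma rtranslP K c x : reflect (exists2 k, k \in K & x = (k * c)%g) (x \in rtransl K c).
Proof. exact: (iffP (imfsetP _ _ _ _)). Qed.

Lemma card_rtransl K c : #|` rtransl K c| = #|` K|.
Proof. by rewrite card_imfset //; exact: mulIg. Qed.

Lemma card_ltransl k A : #|` ltransl k A| = #|` A|.
Proof. by rewrite card_imfset //; exact: mulgI. Qed.

(** The boundary of [A] is measured for one [k] at a time, because for a single [k] entries and
    exits balance. *)
Definition exits k A : nat := #|` [fset t in A | (k * t)%g \notin A]|.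

(* [k A] and [A] have the same size, so as many points enter [A] as leave it. *)
Lemma card_entries k F A :
  (#|` [fset t in F `\` A | (k * t)%g \in A]| <= exits k A)%N.
Proof.
have e1 : (#|` [fset t in F `\` A | (k * t)%g \in A]| <= #|` A `\` ltransl k A|)%N.
  rewrite -(card_ltransl k); apply: fsubset_leq_card; apply/fsubsetP => x /imfsetP[/= t].
  rewrite !inE /= => /andP[/andP[tA _] ktA] ->; rewrite ktA andbT.
  by apply: contra tA => /imfsetP[/= u uA] /mulgI ->.
apply: leq_trans e1 _; rewrite /exits.
have -> : [fset t in A | (k * t)%g \notin A] = A `\` ltransl k^-1%g A.
  apply/fsetP => t; rewrite !inE andbC; case tA: (t \in A); rewrite ?andbF //= !andbT.
  congr (~~ _); apply/idP/imfsetP => [ktA|[/= u uA ->]]; last by rewrite mulVKg.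
  by exists (k * t)%g => //; rewrite mulKg.
rewrite -(card_ltransl k (A `\` ltransl k^-1%g A)).
have -> : ltransl k (A `\` ltransl k^-1%g A) = ltransl k A `\` A.
  apply/fsetP => t; rewrite !inE; apply/imfsetP/andP => [[/= u]|[tA /imfsetP[/= u uA tu]]].
    rewrite !inE => /andP[uk uA] ->; split; last by apply/imfsetP; exists u.
    apply: contra uk => kuA; apply/imfsetP; exists (k * u)%g => //.
    by rewrite mulKg.
  exists u => //; rewrite !inE uA andbT; apply: contra tA => /imfsetP[/= v vA uv].
  by rewrite tu uv mulVKg.
have := cardfsID (ltransl k A) A; have := cardfsID A (ltransl k A).
by rewrite card_ltransl fsetIC => e2 e3; rewrite -(leq_add2l #|` A `&` ltransl k A|) e3 e2.
Qed.

Record subadditive_invariant (h : {fset Γ} -> R) : Prop := {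
  sai_ge0 : forall A, 0 <= h A ;
  sai0 : h fset0 = 0 ;
  saiU : forall A B, h (A `|` B) <= h A + h B ;
  sai_rtransl : forall A c, h (rtransl A c) <= h A }.

Lemma exits_sai k : subadditive_invariant (fun A => (exits k A)%:R).
Proof.
split => [A||A B|A c]; rewrite ?ler0n //.
- suff -> : exits k fset0 = 0%N by [].
  by apply/eqP; rewrite cardfs_eq0; apply/eqP/fsetP => t; rewrite !inE.
- rewrite -natrD ler_nat -cardfsUI; apply: leq_trans (leq_addr _ _).
  apply: fsubset_leq_card; apply/fsubsetP => t; rewrite !inE negb_or.
  by case/andP=> /orP[] -> /andP[-> ->]; rewrite ?orbT.
- rewrite ler_nat /exits -(card_rtransl [fset t in A | (k * t)%g \notin A] c).
  apply: fsubset_leq_card; apply/fsubsetP => t; rewrite !inE /=.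
  move=> /andP[/rtranslP[u uA ->{t}] kn]; apply/rtranslP; exists u => //.
  rewrite !inE uA /=; apply: contra kn => kuA; apply/rtranslP.
  by exists (k * u)%g => //; rewrite mulgA.
Qed.

(* Unions of translates of [K] inside [F], added one by one so that each overlaps
   the previous ones in at most a proportion [ε]. *)
Inductive packed (ε : R) K F : {fset Γ} -> Prop :=
| packed0 : packed ε K F fset0
| packedU A c : packed ε K F A -> rtransl K c `<=` F ->
    #|` A `&` rtransl K c|%:R <= ε * #|` K|%:R ->
    packed ε K F (A `|` rtransl K c).

Lemma packed_sub ε K F A : packed ε K F A -> A `<=` F.
Proof. by elim=> [|B c _ ? ? _]; rewrite ?fsub0set // fsubUset; apply/andP. Qed.

(* Applied to [h] and to the exit counts: [A] inherits from [K] both the bound on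
   [h] and the almost invariance. *)
Lemma packed_le (h : {fset Γ} -> R) ε K F A b : subadditive_invariant h ->
  ε <= 1 -> 0 <= b -> h K <= b * #|` K|%:R -> packed ε K F A ->
  (1 - ε) * h A <= b * #|` A|%:R.
Proof.
move=> hh e1 b0 hK; elim=> [|B c _ IH _ Bc].
  by rewrite (sai0 hh) cardfs0 !mulr0.
have := cardfsUI B (rtransl K c); rewrite card_rtransl => cU.
have {}cU : #|` B `|` rtransl K c|%:R + #|` B `&` rtransl K c|%:R
    = #|` B|%:R + #|` K|%:R :> R by rewrite -!natrD cU.
have le1 : (1 - ε) * h (B `|` rtransl K c) <= (1 - ε) * h B + (1 - ε) * h K.
  rewrite -mulrDr ler_wpM2l ?subr_ge0//; apply: le_trans (saiU hh _ _) _.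
  by rewrite lerD2l; exact: (sai_rtransl hh).
have le2 : (1 - ε) * h K <= (1 - ε) * (b * #|` K|%:R) by rewrite ler_wpM2l ?subr_ge0.
(* The translate brings at least (1 - ε)|K| new points, and these pay for the term (1 - ε) h(K) that
   it adds. *)
have le3 := ler_wpM2l b0 Bc.
apply: le_trans le1 _; apply: le_trans (lerD IH le2) _.
have -> : #|` B `|` rtransl K c|%:R = #|` B|%:R + #|` K|%:R - #|` B `&` rtransl K c|%:R :> R
  by rewrite -cU addrK.
lra.
Qed.

(** An overlap of at most ε|K| < |K| points leaves something new, so each accepted translate
    enlarges [A], and a greedy choice stops inside the finite set [F]. *)
Lemma packed_max ε K F : ε < 1 -> K != fset0 -> exists2 A, packed ε K F A &
  forall c, rtransl K c `<=` F -> ε * #|` K|%:R < #|` A `&` rtransl K c|%:R.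
Proof.
move=> e1 K0; pose maximal A := forall c, rtransl K c `<=` F ->
  ε * #|` K|%:R < #|` A `&` rtransl K c|%:R.
suff H n A : packed ε K F A -> (#|` F| <= n + #|` A|)%N ->
    exists2 A, packed ε K F A & maximal A.
  by apply: (H #|` F| fset0); rewrite ?leq_addr//; constructor.
elim: n A => [|n IH] A pA Fn.
all: have [|/existsNP[c /not_implyP[cF /negP]]] := pselect (maximal A); first by exists A.
all: rewrite -leNgt => Ac; have pU := packedU pA cF Ac.
all: have lt : (#|` A `&` rtransl K c| < #|` K|)%N by
  rewrite -(ltr_nat R); apply: le_lt_trans Ac _;
  rewrite -[ltRHS]mul1r ltr_pM2r// ltr0n cardfs_gt0.
all: have ltU : (#|` A| < #|` A `|` rtransl K c|)%N by
  rewrite -(ltn_add2r #|` A `&` rtransl K c|) cardfsUI card_rtransl ltn_add2l.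
- have := leq_trans ltU (fsubset_leq_card (packed_sub pU)).
  by rewrite ltnNge Fn.
- by apply: (IH _ pU); apply: leq_trans Fn _; rewrite addSnnS leq_add2l.
Qed.

(** Double counting: for fixed [k], left multiplication by [k] is injective, so at most |A| elements
    [c] of [C] satisfy [k * c \in A]. *)
Lemma sum_card_rtransl A K C :
  (\sum_(c <- C) #|` A `&` rtransl K c| <= #|` A| * #|` K|)%N.
Proof.
have E c : #|` A `&` rtransl K c| = (\sum_(k <- K) ((k * c)%g \in A))%N.
  rewrite -card_fset_sum -(card_rtransl [fset k in K | (k * c)%g \in A] c).
  congr (#|` _|); apply/fsetP => x.
  rewrite !inE; apply/andP/rtranslP => [[xA /rtranslP[k kK xE]]|[k]].
    by exists k => //; rewrite !inE kK -xE.
  rewrite !inE /= => /andP[kK kcA] ->; split => //.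
  by apply/rtranslP; exists k.
under eq_bigr do rewrite E.
rewrite exchange_big /= mulnC -sum1_size big_distrl /=; apply: leq_sum => k _.
rewrite -card_fset_sum mul1n -(card_ltransl k).
apply: fsubset_leq_card; apply/fsubsetP => x /imfsetP[/= c].
by rewrite !inE /= => /andP[_ kc] ->.
Qed.

Lemma rtransl_subP K c F :
  reflect (forall k, k \in K -> (k * c)%g \in F) (rtransl K c `<=` F).
Proof.
apply: (iffP idP) => [/fsubsetP H k kK|H]; first by apply: H; apply/rtranslP; exists k.
by apply/fsubsetP => x /rtranslP[k kK ->]; exact: H.
Qed.

Lemma almost_inv_le K K' (δ δ' : R) F : K `<=` K' -> δ' <= δ ->
  almost_inv K' δ' F -> almost_inv K δ F.
Proof.
move=> KK' le [F0 HF]; split=> //; apply: le_trans (le_trans _ HF) _.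
  by rewrite ler_wpM2r// lerB.
rewrite ler_nat; apply: fsubset_leq_card; apply/fsubsetP => t.
rewrite !inE /= => /andP[-> /rtransl_subP H] /=; apply/rtransl_subP => k kK.
exact/H/(fsubsetP KK').
Qed.

Lemma almost_invP K (δ : R) F : F != fset0 ->
  almost_inv K δ F <-> #|` [fset t in F | ~~ (rtransl K t `<=` F)]|%:R <= δ * #|` F|%:R.
Proof.
move=> F0; have := card_fset_predC F (fun t => rtransl K t `<=` F).
set a := #|` _|; set b := #|` _| => ab.
have {}ab : a%:R + b%:R = #|` F|%:R :> R by rewrite -natrD ab.
rewrite /almost_inv /= -/a; split=> [[_]|]; first lra.
by move=> H; split => //; lra.
Qed.

Lemma almost_inv_exits K (δ : R) F k : almost_inv K δ F -> k \in K ->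
  (exits k F)%:R <= δ * #|` F|%:R.
Proof.
move=> HF kK; have F0 := HF.1; move/(almost_invP _ _ F0): HF; apply: le_trans.
rewrite ler_nat; apply: fsubset_leq_card; apply/fsubsetP => t.
rewrite !inE /= => /andP[-> kt] /=; apply: contra kt => /rtransl_subP; exact.
Qed.

(** If [K t] leaves [F \ A], then it leaves [F] or some [k t] lands in [A]; the latter are entries
    into [A], bounded by [card_entries]. *)
Lemma exits_setD K F A :
  (#|` [fset t in F `\` A | ~~ (rtransl K t `<=` F `\` A)]| <=
   #|` [fset t in F | ~~ (rtransl K t `<=` F)]| + \sum_(k <- K) exits k A)%N.
Proof.
pose a t : nat := ~~ (rtransl K t `<=` F).
pose b k t : nat := (k * t)%g \in A.
apply: (@leq_trans (\sum_(t <- F `\` A) (a t + \sum_(k <- K) b k t))).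
  rewrite card_fset_sum; apply: leq_sum => t _.
  case: rtransl_subP => // /existsNP[k /not_implyP[kK /negP]].
  rewrite in_fsetD negb_and negbK => /orP[kA|kF]; last first.
    rewrite /a; case: rtransl_subP => // H.
    by rewrite H in kF.
  by rewrite (big_fsetD1 k)//= /b kA addnCA.
rewrite big_split /= exchange_big /=; apply: leq_add.
  rewrite -card_fset_sum; apply: fsubset_leq_card; apply/fsubsetP => t.
  by rewrite !inE => /andP[/andP[_ ->] ->].
by apply: leq_sum => k _; rewrite -card_fset_sum; exact: card_entries.
Qed.

(** The order of choices matters: δ1 is fixed before the tile [K], and the invariance demanded of
    [F] may depend on [K]. The set [A] is a maximal packing. *)
Lemma packing_step K0 (δ0 ε : R) : K0 != fset0 -> 0 < δ0 -> 0 < ε -> ε < 1 ->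
  exists2 δ1 : R, 0 < δ1 & forall K, almost_inv K0 δ1 K ->
  exists K2 (δ2 : R), [/\ K2 != fset0, 0 < δ2 & forall F, almost_inv K2 δ2 F ->
  exists A, [/\ packed ε K F A, ε / 2 * #|` F|%:R <= #|` A|%:R &
    #|` F `\` A|%:R <= ε * #|` F|%:R \/ almost_inv K0 δ0 (F `\` A)]].
Proof.
move=> K00 δ00 e0 e1.
have cK0 : 0 < #|` K0|%:R :> R by rewrite ltr0n cardfs_gt0.
(* By [packed_le], each [k] in [K0] has at most δ1 |A| / (1 - ε) exits from [A]; summed over [K0]
   this is ε δ0 |A| / 2. *)
pose δ1 : R := ε * δ0 * (1 - ε) / 2 / #|` K0|%:R.
exists δ1; first by rewrite !divr_gt0 ?mulr_gt0 ?subr_gt0.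
move=> K HK; have Kn0 := HK.1.
(* The pair [K], 1/2 makes at least half of the points of [F] centres of translates inside [F]; the
   pair [K0], ε δ0 / 2 controls the boundary of [F]. *)
exists (K `|` K0), (Num.min (2^-1) (ε * δ0 / 2)); split.
- by rewrite fsetU_eq0 negb_and Kn0.
- by rewrite lt_min invr_gt0 ltr0n /= divr_gt0// mulr_gt0.
move=> F HF; have F0 := HF.1.
have [A pA Amax] := packed_max F e1 Kn0.
have cK : 0 < #|` K|%:R :> R by rewrite ltr0n cardfs_gt0.
have cF : 0 < #|` F|%:R :> R by rewrite ltr0n cardfs_gt0.
have AF := packed_sub pA.
exists A; split => //.
  have : almost_inv K (2^-1 : R) F.
    by apply: almost_inv_le HF; rewrite ?fsubsetUl// ge_min lexx.
  case=> _; set C := [fset t in F | _] => HC.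
  (* By maximality every centre in [C] has overlap above ε|K|, so double counting gives ε|C| <=
     |A|. *)
  have := sum_card_rtransl A K C; rewrite -(ler_nat R) natrM natr_sum => le1.
  have : ε * #|` K|%:R * #|` C|%:R <= #|` A|%:R * #|` K|%:R.
    apply: le_trans le1; rewrite (card_fset_sum1 C) natr_sum mulr_sumr.
    rewrite big_seq [leRHS]big_seq; apply: ler_sum => c cC.
    rewrite mulr1 ltW//; apply: Amax.
    by move: cC; rewrite !inE => /andP[].
  rewrite mulrAC ler_pM2r// => le2; apply: le_trans le2.
  have e0' := ltW e0; have := ler_wpM2l e0' HC; lra.
have [|cD] := leP #|` F `\` A|%:R (ε * #|` F|%:R); [by left|right].
have cD0 : 0 < #|` F `\` A|%:R :> R by apply: lt_trans cD; rewrite mulr_gt0.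
apply/almost_invP; first by rewrite -cardfs_gt0 -(ltr_nat R).
have := exits_setD K0 F A; rewrite -(ler_nat R) natrD natr_sum => le1.
apply: le_trans le1 _.
have : almost_inv K0 (ε * δ0 / 2) F.
  by apply: almost_inv_le HF; rewrite ?fsubsetUr// ge_min lexx orbT.
move/(almost_invP _ _ F0) => le2.
have le3 : \sum_(k <- K0) (exits k A)%:R <= ε * δ0 / 2 * #|` F|%:R.
  apply: (@le_trans _ _ (\sum_(k <- K0) (ε * δ0 / 2 / #|` K0|%:R * #|` A|%:R))).
    rewrite big_seq [leRHS]big_seq; apply: ler_sum => k kK0.
    have d0 : 0 <= δ1 by rewrite /δ1 !divr_ge0 ?mulr_ge0 ?subr_ge0 ?ltW.
    have e1' : 0 < 1 - ε by rewrite subr_gt0.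
    have := packed_le (exits_sai k) (ltW e1) d0 (almost_inv_exits HK kK0) pA.
    rewrite -(ler_pM2l e1'); move/le_trans; apply.
    by rewrite /δ1 le_eqVlt; apply/orP; left; apply/eqP; ring.
  rewrite big_tnth sumr_const card_ord -[leLHS]mulr_natr.
  rewrite [leLHS](_ : _ = ε * δ0 / 2 * #|` A|%:R); last by field; rewrite gt_eqF.
  rewrite ler_pM2l ?ler_nat ?fsubset_leq_card//.
  by rewrite divr_gt0 ?mulr_gt0.
(* The two bounds add up to ε δ0 |F|, which is below δ0 |F \ A| since the remainder has more than
   ε|F| points. *)
have le4 := ler_wpM2l (ltW δ00) (ltW cD).
apply: le_trans (lerD le2 le3) _; apply: le_trans le4; lra.
Qed.

Lemma folner_filter_proper : amenable R Γ -> ProperFilter (folner_filter R Γ).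
Proof.
move=> am; apply: filter_from_proper; last by move=> [K δ] [/= ? ?]; exact: am.
apply: filter_from_filter.
  by exists ([fset 1%g], 1); split => //=; rewrite -cardfs_gt0 cardfs1.
move=> [K δ] [K' δ'] [/= K0 δ0] [/= K'0 δ'0].
exists (K `|` K', Num.min δ δ').
  by split => /=; rewrite ?lt_min ?δ0// fsetU_eq0 negb_and K0.
by move=> F HF; split; apply: almost_inv_le HF;
  rewrite /= ?fsubsetUl ?fsubsetUr// ge_min lexx ?orbT.
Qed.

(** Every singleton is a right translate of [[fset 1%g]]. This crude bound takes care of negligible
    remainders. *)
Lemma sai_le_card h : subadditive_invariant h ->
  forall A, h A <= h [fset 1%g] * #|` A|%:R.
Proof.
move=> hh; elim/finSet_rect => A IH.
have [->|/fset0Pn[a aA]] := eqVneq A fset0; first by rewrite (sai0 hh) cardfs0 mulr0.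
rewrite -(fsetD1K aA); apply: le_trans (saiU hh _ _) _.
rewrite cardfsU1 !inE eqxx /= natrD mulrDr mulr1 lerD//; last first.
  by apply: IH; exact: fproperD1.
have -> : [fset a] = rtransl [fset 1%g] a.
  apply/fsetP => x; rewrite !inE; apply/eqP/rtranslP => [->|[k]].
    by exists 1%g; rewrite ?inE ?mul1g.
  by rewrite inE => /eqP -> ->; rewrite mul1g.
exact: (sai_rtransl hh).
Qed.

Lemma sai_improve h (α b : R) : subadditive_invariant h -> b < α -> 0 <= b ->
  (forall a, α < a -> folner_filter R Γ [set F | h F <= a * #|` F|%:R]%classic) ->
  (forall K (δ : R), K != fset0 -> 0 < δ ->
    exists2 F, almost_inv K δ F & h F <= b * #|` F|%:R) ->
  exists2 a, a < α & folner_filter R Γ [set F | h F <= a * #|` F|%:R]%classic.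
Proof.
move=> hh ba b0 Hup Hfreq.
set M := h [fset 1%g]; have M0 : 0 <= M := sai_ge0 hh _.
pose η := α - b; have η0 : 0 < η by rewrite subr_gt0.
have D0 : 0 < 2 * b + M + 1 by lra.
(* Chosen so that the overlaps and a negligible remainder together cost at most η / 2; the summand 1
   keeps the denominator positive. *)
pose ε := Num.min (2^-1) (η / 2 / (2 * b + M + 1)).
have e0 : 0 < ε by rewrite lt_min invr_gt0 ltr0n /= !divr_gt0.
have e2 : ε <= 2^-1 by rewrite ge_min lexx.
have e1 : ε < 1 by lra.
have eη : (2 * b + M) * ε <= η / 2.
  have : ε * (2 * b + M + 1) <= η / 2.
    by rewrite -ler_pdivlMr// ge_min lexx orbT.
  by have := ltW e0; lra.
have ηe0 : 0 < η * ε by rewrite mulr_gt0.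
(* A polynomial substitute for b / (1 - ε), valid because ε <= 1/2. *)
pose β := b + 2 * b * ε.
have be0 : 0 <= b * ε by rewrite mulr_ge0// ltW.
have Me0 : 0 <= M * ε by rewrite mulr_ge0// ltW.
have βη : β + M * ε <= α - η / 2 by rewrite /β /η; move: eη; rewrite /η; lra.
have bβ : b <= (1 - ε) * β.
  have := ler_wpM2l be0 e2; rewrite /β; lra.
have αa : α < α + η * ε / 8 by rewrite ltrDl divr_gt0.
have [[K0 δ0] [/= K00 δ00] HK0] := Hup _ αa.
have [δ1 δ10 Hpack] := packing_step K00 δ00 e0 e1.
have [K HK hK] := Hfreq _ _ K00 δ10.
have [K2 [δ2 [K20 δ20 HF]]] := Hpack _ HK.
exists (α - η * ε / 8); first by rewrite gtrBl divr_gt0.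
exists (K2, δ2) => //= F /HF[A [pA cA FA]] /=.
have hA : h A <= β * #|` A|%:R.
  have e1' : 0 < 1 - ε by rewrite subr_gt0.
  rewrite -(ler_pM2l e1') mulrA; apply: le_trans (packed_le hh (ltW e1) b0 hK pA) _.
  by rewrite ler_wpM2r.
have AF := packed_sub pA.
have cD : #|` F `\` A|%:R = #|` F|%:R - #|` A|%:R :> R.
  by rewrite cardfsDS// natrB// fsubset_leq_card.
have hF : h F <= h A + h (F `\` A).
  by rewrite -{1}(fsetID A F) (fsetIidPr AF); exact: (saiU hh).
have cF0 : 0 <= #|` F|%:R :> R by [].
have cAF : #|` A|%:R <= #|` F|%:R :> R by rewrite ler_nat fsubset_leq_card.
case: FA => [cD1|/HK0 /= hD].
  (* Negligible remainder: h(F) <= (β + M ε)|F|. *)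
  have hD := sai_le_card hh (F `\` A).
  have := ler_wpM2l M0 cD1; have β0 : 0 <= β by rewrite /β; lra.
  have := ler_wpM2l β0 cAF.
  have : β + M * ε <= α - η * ε / 8.
    have := ler_wpM2l (ltW η0) e2; lra.
  move/(ler_wpM2r cF0); rewrite -/M in hD; lra.
(* Invariant remainder: on [A], at least ε|F| / 2 points, the gain per point is at least η / 2. The
   total gain η ε |F| / 4 outweighs the excess η ε |F| / 8 of the bound for the remainder. *)
have aβ : η / 2 <= α + η * ε / 8 - β by lra.
have aβ0 : 0 <= α + η * ε / 8 - β by lra.
have := ler_wpM2l aβ0 cA.
have eF0 : 0 <= ε / 2 * #|` F|%:R by rewrite mulr_ge0// divr_ge0 ?ltW.
have := ler_wpM2r eF0 aβ.
rewrite cD in hD; lra.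
Qed.

Theorem ornstein_weiss h : amenable R Γ -> subadditive_invariant h ->
  exists l : R, h F / #|` F|%:R @[F --> folner_filter R Γ] --> l.
Proof.
move=> am hh; have PF := folner_filter_proper am.
have card_gt0 : folner_filter R Γ [set F | 0 < #|` F|%:R :> R]%classic.
  exists ([fset 1%g], 1); first by split => //=; rewrite -cardfs_gt0 cardfs1.
  by move=> F [F0 _] /=; rewrite ltr0n cardfs_gt0.
pose S : set R := [set a | folner_filter R Γ [set F | h F <= a * #|` F|%:R]]%classic.
have Slb : lbound S 0.
  move=> a Sa; have [F [/= F0 Fa]] := filter_ex (filterI card_gt0 Sa).
  have := le_trans (sai_ge0 hh F) Fa; by rewrite pmulr_lge0.
have Sinf : has_inf S.
  split; last by exists 0.
  exists (h [fset 1%g]); apply: filterE => F; exact: sai_le_card.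
have up a : inf S < a -> folner_filter R Γ [set F | h F <= a * #|` F|%:R]%classic.
  move=> /inf_lt -/(_ Sinf.1)[c Sc ca].
  apply: filterS Sc => F /= /le_trans; apply; rewrite ler_wpM2r//; exact: ltW.
exists (inf S); apply/cvgrPdist_lt => e e0.
have up2 := up (inf S + e / 2) _.
have low : folner_filter R Γ [set F | (inf S - e / 2) * #|` F|%:R < h F]%classic.
  (* If the lower bound is not eventual, every basic set of the filter contains a violating [F].
     Then [sai_improve] yields an element of [S] below its infimum. *)
  apply: contrapT => nlow.
  have freq K (δ : R) : K != fset0 -> 0 < δ ->
      exists2 F, almost_inv K δ F & h F <= (inf S - e / 2) * #|` F|%:R.
    move=> K0 δ0; apply: contrapT => nex; apply: nlow.
    exists (K, δ) => //= F HF /=; rewrite ltNge; apply/negP => le.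
    by apply: nex; exists F.
  have b0 : 0 <= inf S - e / 2.
    have K0 : [fset 1%g : Γ] != fset0 by rewrite -cardfs_gt0 cardfs1.
    have [F [F0 _] hF] := freq [fset 1%g] 1 K0 ltr01.
    have := le_trans (sai_ge0 hh F) hF.
    by rewrite pmulr_lge0// ltr0n cardfs_gt0.
  have lt : inf S - e / 2 < inf S by rewrite gtrBl divr_gt0.
  have [a aS Sa] := sai_improve hh lt b0 up freq.
  have := @ge_inf _ S Sinf.2 a Sa; by rewrite leNgt aS.
have {}up2 : folner_filter R Γ [set F | h F <= (inf S + e / 2) * #|` F|%:R]%classic.
  by apply: up2; rewrite ltrDl divr_gt0.
apply: filterS (filterI card_gt0 (filterI low up2)) => F /= [F0 [lo hi]].
rewrite -ltr_pdivlMr// in lo; rewrite -ler_pdivrMr// in hi.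
rewrite ltr_norml; lra.
Qed.
End OrnsteinWeiss.

(** * Covers of bounded order *)

Section NatExtrema.
Implicit Type S : set nat.

Lemma nat_infimumP S : S !=set0 ->
  S (infimum 0%N S) /\ forall n, S n -> (infimum 0%N S <= n)%N.
Proof.
move=> S0.
have exS : exists n, n \in S by case: S0 => n Sn; exists n; rewrite inE.
have Sm : S (ex_minn exS) by case: ex_minnP => m; rewrite inE.
have lbm : lbound S (ex_minn exS).
  by move=> n Sn; rewrite leEnat; case: ex_minnP => m _; apply; rewrite inE.
have infm : infimums S (ex_minn exS) by split=> // n; exact.
have -> : infimum 0%N S = ex_minn exS.
  have : infimums S (infimum 0%N S).
    rewrite /infimum ifF; last by apply/negbTE/set0P.
    by apply: xgetPex; exists (ex_minn exS).
  move=> h; exact: (is_subset1_infimums h infm).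
by split=> // n /lbm; rewrite leEnat.
Qed.

Lemma nat_supremum_le S n : (forall m, S m -> (m <= n)%N) -> (supremum 0%N S <= n)%N.
Proof.
move=> ubn; rewrite /supremum; case: ifPn => // S0.
case: xgetP => [m -> [_ lub]|_] //.
by have := lub n; rewrite leEnat; apply => m' /ubn; rewrite leEnat.
Qed.

Lemma nat_supremum_ge S n m : (forall m, S m -> (m <= n)%N) -> S m -> (m <= supremum 0%N S)%N.
Proof.
move=> ubn Sm; have := @ge_supremum_Nmem _ _ 0%N S m; rewrite leEnat; apply => //.
by apply: nat_supremums_neq0; exists n => k /ubn; rewrite leEnat.
Qed.

End NatExtrema.

Section HasCover.
Implicit Types T : topologicalType.

(** Indexed families may repeat members, so preimages and pairings need no identification of equal
    sets. The bound [k.+1] matches the subtraction of 1 in [cover_ord]. *)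
Definition has_cover T (P : set T -> Prop) (k : nat) : Prop :=
  exists (I : finType) (W : I -> set T),
    [/\ forall i, open (W i), forall x, exists i, W i x, forall i, P (W i) &
        forall x, (\sum_i (x \in W i) <= k.+1)%N].

Lemma has_cover_preimage (S T : topologicalType) (f : S -> T)
    (P : set T -> Prop) (Q : set S -> Prop) k :
  continuous f -> (forall B, P B -> Q (f @^-1` B)) ->
  has_cover P k -> has_cover Q k.
Proof.
move=> cf PQ [I [W [oW cW PW kW]]]; exists I, (fun i => f @^-1` W i).
split=> [i|x|i|x]; [exact: open_comp|exact: cW|exact: PQ|].
apply: leq_trans (kW (f x)); apply: leq_sum => i _.
have -> // : (x \in f @^-1` W i) = (f x \in W i).
by apply/idP/idP; rewrite !inE.
Qed.

Definition under_cover (T : Type) (U : {fset set T}) (B : set T) : Prop :=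
  exists2 A, A \in U & B `<=` A.

(** Passing from an indexed family to its set of members can only merge members, so no multiplicity
    grows. *)
Lemma cover_D_leP T (U : {fset set T}) k : fin_open_cover U ->
  (cover_D U <= k)%N <-> has_cover (under_cover U) k.
Proof.
move=> cU; rewrite /cover_D; set S := (X in infimum _ X).
have [|/= SD Smin] := @nat_infimumP S.
  by exists (cover_ord U); exists U => //; split => // A AU; exists A.
split=> [Sk|[I [W [oW cW UW kW]]]].
  case: SD => W [[oW cW] rW] WD.
  exists (W : finType), (fun i => val i); split=> [[A AW]|x|[A AW]|x] /=.
  - exact: oW.
  - by have [A AW Ax] := cW x; exists [` AW]%fset.
  - exact: rW.
  - rewrite -(big_seq_fsetE _ W predT (fun A => nat_of_bool (x \in A))) /=.
    apply: (@leq_trans (cover_ord W).+1); last by rewrite ltnS WD.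
    rewrite /cover_ord subn1; apply: leq_trans (leqSpred _).
    apply: (@nat_supremum_ge _ #|` W|); last by exists x.
    move=> _ [y _ <-]; rewrite card_fset_sum1; apply: leq_sum => A _.
    exact: leq_b1.
pose W' : {fset set T} := [fset W i | i in I]%fset.
apply: leq_trans (Smin (cover_ord W') _) _.
  exists W' => //; split; [split=> [A|x]|move=> A].
  - by case/imfsetP => i _ ->; exact: oW.
  - by have [i Wi] := cW x; exists (W i) => //; apply/imfsetP; exists i.
  - by case/imfsetP => i _ ->; exact: UW.
rewrite leq_subLR add1n; apply: nat_supremum_le => _ [x _ <-].
apply: leq_trans (kW x).
rewrite -card_fset_sum; pose N := [pred i | x \in W i].
have -> : (\sum_i (x \in W i) = #|N|)%N by rewrite -sum1_card [RHS]big_mkcond.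
apply: (@leq_trans #|` [fset W i | i in N]%fset|); last first.
  by apply: leq_trans (leq_imfset_card _ _ _) _; rewrite /= -cardE.
apply: fsubset_leq_card; apply/fsubsetP => A.
rewrite !inE /= => /andP[/imfsetP[i _ ->] xi]; apply/imfsetP; exists i => //.
Qed.

(** * Joins and preimages of covers *)

Section Joins.
Context (Γ : groupType) (T : topologicalType) (act : Γ -> T -> T).
Implicit Types (U V : {fset set T}) (F : {fset Γ}).

Lemma fin_open_cover_join U V : fin_open_cover U -> fin_open_cover V ->
  fin_open_cover (cover_join U V).
Proof.
move=> [oU cU] [oV cV]; split=> [C /imfset2P[A /= AU [B /= BV ->]]|x].
  by apply: openI; [exact: oU|exact: oV].
have [A AU Ax] := cU x; have [B BV Bx] := cV x.
by exists (A `&` B) => //; apply/imfset2P; exists A => //; exists B.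
Qed.

Lemma fin_open_cover_preimage (S : topologicalType) (f : S -> T) U : continuous f ->
  fin_open_cover U -> fin_open_cover (cover_preimage f U).
Proof.
move=> cf [oU cU]; split=> [C /imfsetP[A /= AU ->]|x].
  by apply: open_comp => //; exact: oU.
have [A AU Ax] := cU (f x); exists (f @^-1` A) => //.
by apply/imfsetP; exists A.
Qed.

Lemma under_preimage S (f : S -> T) U B :
  under_cover (cover_preimage f U) B <->
  (exists2 A, A \in U & B `<=` f @^-1` A).
Proof.
split=> [[_ /imfsetP[A /= AU ->] BA]|[A AU BA]]; first by exists A.
by exists (f @^-1` A) => //; apply/imfsetP; exists A.
Qed.

Lemma under_cover_join U V B : under_cover (cover_join U V) B <->
  under_cover U B /\ under_cover V B.
Proof.
split=> [[_ /imfset2P[A /= AU [C /= CV ->]] BAC]|[[A AU BA] [C CV BC]]].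
  by split; [exists A|exists C] => // x /BAC[].
exists (A `&` C); first by apply/imfset2P; exists A => //; exists C.
by move=> x Bx; split; [exact: BA|exact: BC].
Qed.

Lemma fin_open_cover_dyn U F : (forall s, continuous (act s)) ->
  fin_open_cover U -> fin_open_cover (cover_dyn act U F).
Proof.
move=> cact cU; rewrite /cover_dyn; apply: big_ind => [|*|s _].
- split=> [A|x]; first by rewrite inE => /eqP ->; exact: openT.
  by exists setT; rewrite ?inE.
- exact: fin_open_cover_join.
- exact: fin_open_cover_preimage.
Qed.

(** The members for different [s] are chosen independently, so [F] enters only through membership;
    unions and translates of [F] become easy to treat. *)
Lemma under_cover_dyn U F B : under_cover (cover_dyn act U F) B <->
  (forall s, s \in F -> exists2 A, A \in U & B `<=` act s @^-1` A).
Proof.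
rewrite /cover_dyn; change (forall s, _) with
  (forall s, s \in enum_fset F -> exists2 A, A \in U & B `<=` act s @^-1` A).
elim: (enum_fset F) => [|s r IH].
  by rewrite big_nil; split=> // _; exists setT; rewrite ?inE.
rewrite big_cons under_cover_join IH; split=> [[/under_preimage Bs Br] t|H].
  by rewrite inE => /orP[/eqP ->|/Br].
split; first by apply/under_preimage/H; rewrite mem_head.
by move=> t tr; apply: H; rewrite inE tr orbT.
Qed.

End Joins.

End HasCover.

(** * Metrics, partitions of unity and joins of covers *)

Lemma continuous_sum (R : realType) (T : topologicalType) (I : Type) (r : seq I)
    (P : pred I) (f : I -> T -> R) : (forall i, P i -> continuous (f i)) ->
  continuous (fun x => \sum_(i <- r | P i) f i x)%R.
Proof. by move=> cf; apply: continuous_big => //; exact: add_continuous. Qed.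

Section Metric.
Local Open Scope ring_scope.
Context {R : realType} {T : topologicalType} (d : T -> T -> R).

Record topology_metric : Prop := {
  tm_eq0 : forall x y, d x y = 0 <-> x = y ;
  tm_sym : forall x y, d x y = d y x ;
  tm_triangle : forall x y z, d x z <= d x y + d y z ;
  tm_nbhs : forall x : T, nbhs x =
    filter_from [set e : R | 0 < e] (fun e => [set y | d x y < e]) }.

Hypothesis dm : topology_metric.

Lemma tm_refl x : d x x = 0.
Proof. exact/(tm_eq0 dm). Qed.

Lemma tm_ge0 x y : 0 <= d x y.
Proof.
have := tm_triangle dm x y x; rewrite tm_refl (tm_sym dm y x); lra.
Qed.

Lemma near_tm x e : 0 < e -> \forall y \near x, d x y < e.
Proof. by move=> e0; rewrite /prop_near1 (tm_nbhs dm); exists e. Qed.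

Lemma continuous_tm : continuous (fun p : T * T => d p.1 p.2).
Proof.
move=> [x y] /=; apply/cvgrPdist_lt => e e0.
have e20 : 0 < e / 2 by rewrite divr_gt0.
have Hx : \forall p \near (x, y), d x p.1 < e / 2.
  exact: (@cvg_fst _ _ (nbhs x) (nbhs y) _ _ (near_tm x e20)).
have Hy : \forall p \near (x, y), d y p.2 < e / 2.
  exact: (@cvg_snd _ _ (nbhs x) (nbhs y) _ _ (near_tm y e20)).
near=> p.
have px : d x p.1 < e / 2 by near: p.
have py : d y p.2 < e / 2 by near: p.
have := tm_triangle dm x p.1 y; have := tm_triangle dm p.1 p.2 y.
have := tm_triangle dm p.1 x p.2; have := tm_triangle dm x y p.2.
rewrite (tm_sym dm p.1 x) (tm_sym dm p.2 y) ltr_norml => *; lra.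
Unshelve. all: by end_near. Qed.

(* The value 1 keeps the infimum meaningful when [A] is the whole space. *)
Definition gap (A : set T) (x : T) : R :=
  inf [set r | r = 1 \/ exists2 y, ~ A y & r = d x y].

Lemma gap_lbound A x : has_lbound [set r | r = 1 \/ exists2 y, ~ A y & r = d x y].
Proof. by exists 0 => r [->|[y _ ->]]; rewrite ?tm_ge0. Qed.

Lemma gap_ge0 A x : 0 <= gap A x.
Proof.
apply: lb_le_inf; first by exists 1; left.
by move=> r [->|[y _ ->]]; rewrite ?tm_ge0.
Qed.

Lemma lt_gap A x y : d x y < gap A x -> A y.
Proof.
move=> dlt; apply: contrapT => nAy.
have : gap A x <= d x y by apply: ge_inf; [exact: gap_lbound|right; exists y].
by rewrite leNgt dlt.
Qed.

Lemma gap_gt0 A x : open A -> (0 < gap A x) <-> A x.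
Proof.
move=> oA; split=> [g0|Ax]; first by apply: (@lt_gap A x); rewrite tm_refl.
have : nbhs x A by exact: open_nbhs_nbhs.
rewrite (tm_nbhs dm) => -[e /= e0 eA].
apply: (@lt_le_trans _ _ (Num.min 1 e)); first by rewrite lt_min ltr01.
apply: lb_le_inf; first by exists 1; left.
move=> r [->|[y nAy ->]]; first by rewrite ge_min lexx.
by rewrite ge_min; apply/orP; right; rewrite leNgt; apply/negP => /eA.
Qed.

Lemma gap_lipschitz A x y : gap A x <= gap A y + d x y.
Proof.
rewrite -lerBlDr; apply: lb_le_inf; first by exists 1; left.
move=> r [->|[z nAz ->]]; rewrite lerBlDr.
  apply: (@le_trans _ _ 1); last by rewrite lerDl tm_ge0.
  by apply: ge_inf; [exact: gap_lbound|left].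
apply: (@le_trans _ _ (d x z)).
  by apply: ge_inf; [exact: gap_lbound|right; exists z].
by rewrite addrC; exact: tm_triangle.
Qed.

Lemma continuous_gap A : continuous (gap A).
Proof.
move=> x; apply/cvgrPdist_lt => e e0; near=> y.
have dxy : d x y < e by near: y; exact: near_tm.
have := gap_lipschitz A x y; have := gap_lipschitz A y x.
rewrite (tm_sym dm y x) ltr_norml => *; lra.
Unshelve. all: by end_near. Qed.

(** Normalised gaps. Positivity exactly on [W i] lets the multiplicity of the cover count the
    nondegenerate intervals of the subdivision. *)
Lemma partition_of_unity (I : finType) (W : I -> set T) :
  (forall i, open (W i)) -> (forall x, exists i, W i x) ->
  exists p : I -> T -> R, [/\ forall i, continuous (p i), forall i x, 0 <= p i x,
    forall i x, 0 < p i x <-> W i x & forall x, \sum_i p i x = 1].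
Proof.
move=> oW cW; pose s x := \sum_i gap (W i) x.
have s0 x : 0 < s x.
  have [i Wi] := cW x; rewrite /s (bigD1 i)//=.
  by rewrite ltr_wpDr ?sumr_ge0//; [move=> *; exact: gap_ge0|exact/gap_gt0].
have cs : continuous s by apply: continuous_sum => i _; exact: continuous_gap.
exists (fun i x => gap (W i) x / s x); split=> [i|i x|i x|x].
- move=> x; apply: cvgM; first exact: continuous_gap.
  apply: cvgV; first by rewrite gt_eqF.
  exact: cs.
- by rewrite divr_ge0 ?gap_ge0// ltW.
- by rewrite pmulr_lgt0 ?invr_gt0//; exact: gap_gt0.
- by rewrite -mulr_suml -/(s x) divff// gt_eqF.
Qed.

End Metric.

(** * Overlaps of two subdivisions of the unit interval *)

Section Shuffle.
Local Open Scope ring_scope.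
Context {R : realType}.

(** Left end of the interval of length [p i] when the intervals are laid end to end in the order of
    the enumeration of [I]. *)
Definition lo (I : finType) (p : I -> R) (i : I) : R :=
  \sum_(i' | (enum_rank i' < enum_rank i)%N) p i'.

(** A signed length, negative for intervals that are apart: it stays continuous in the end points,
    and its positivity detects a nondegenerate intersection. *)
Definition overlap (I J : finType) (p : I -> R) (q : J -> R) (i : I) (j : J) : R :=
  Num.min (lo p i + p i) (lo q j + q j) - Num.max (lo p i) (lo q j).

Section Intervals.
Context (I : finType) (p : I -> R).
Hypothesis p0 : forall i, 0 <= p i.

Lemma lo_ge0 i : 0 <= lo p i. Proof. exact: sumr_ge0. Qed.

Lemma lo_le i i' : (enum_rank i < enum_rank i')%N -> lo p i + p i <= lo p i'.
Proof.
move=> ii'; rewrite /lo [leRHS](bigD1 i)//= [leRHS]addrC lerD2r.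
rewrite big_mkcond [leRHS]big_mkcond /=; apply: ler_sum => k _.
case: ifP => [ki|_]; last by case: ifP.
rewrite (ltn_trans ki ii') /=; case: eqP => //= ki'.
by rewrite ki' ltnn in ki.
Qed.

Lemma lo_inj i i' x : lo p i <= x -> x < lo p i + p i ->
  lo p i' <= x -> x < lo p i' + p i' -> i = i'.
Proof.
move=> a b a' b'; case: (ltngtP (enum_rank i) (enum_rank i')) => [lt|lt|eq].
- by have := le_trans (lo_le lt) a'; rewrite leNgt b.
- by have := le_trans (lo_le lt) a; rewrite leNgt b'.
- by apply: enum_rank_inj; apply: val_inj.
Qed.

(** Take the first interval of positive length: those before it contribute nothing. *)
Lemma lo_eq0 : \sum_i p i = 1 -> exists2 i, 0 < p i & lo p i = 0.
Proof.
move=> p1; have [i0 pi0] : exists i, 0 < p i.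
  apply: contrapT => np; have : \sum_i p i = 0.
    apply: big1 => i _; apply/eqP; rewrite eq_le p0 andbT leNgt.
    by apply/negP => pi; apply: np; exists i.
  by rewrite p1 => /eqP; rewrite oner_eq0.
case: (@arg_minnP I i0 (fun i => 0 < p i) (fun i => enum_rank i : nat) pi0) => i pi imin.
exists i => //.
apply: big1 => k ki; apply/eqP; rewrite eq_le p0 andbT leNgt.
by apply/negP => /imin; rewrite leqNgt ki.
Qed.

End Intervals.

Context (I J : finType) (p : I -> R) (q : J -> R).
Hypotheses (p0 : forall i, 0 <= p i) (q0 : forall j, 0 <= q j).
Hypotheses (p1 : \sum_i p i = 1) (q1 : \sum_j q j = 1).

Lemma overlap_gt0 i j : 0 < overlap p q i j <->
  [/\ 0 < p i, 0 < q j, lo p i < lo q j + q j & lo q j < lo p i + p i].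
Proof.
rewrite subr_gt0 lt_min !gt_max -!andbA.
split=> [/and4P[]|[]] *; last by apply/and4P; split; lra.
by split; lra.
Qed.

Lemma overlap_ex : exists i j, 0 < overlap p q i j.
Proof.
have [i pi loi] := lo_eq0 p0 p1; have [j qj loj] := lo_eq0 q0 q1.
by exists i, j; apply/overlap_gt0; rewrite loi loj !add0r.
Qed.

(* A pair of overlapping intervals is determined by the left end of the overlap:
   this is the left end of the interval of [p] or of [q], and 0 is shared. *)
Lemma overlap_card :
  (\sum_i \sum_j (0 < overlap p q i j)%R < \sum_i (0 < p i)%R + \sum_j (0 < q j)%R)%N.
Proof.
have [j0 qj0 loj0] := lo_eq0 q0 q1.
pose A := [pred x : I * J | 0 < overlap p q x.1 x.2].
pose f (x : I * J) : I + J := if lo q x.2 <= lo p x.1 then inl x.1 else inr x.2.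
(* Ties in [f] go to [p] and [j0] starts at 0, so [inr j0] is never a value; removing it makes the
   inequality strict. *)
pose B := [pred s : I + J |
  match s with inl i => 0 < p i | inr j => (j != j0) && (0 < q j) end].
have finj : {in A &, injective f}.
  move=> [i j] [i' j']; rewrite !inE /= /f /=.
  move=> /overlap_gt0[pi qj a b] /overlap_gt0[pi' qj' a' b'].
  case: (leP (lo q j)) => c; case: (leP (lo q j')) => c' // -[].
    move=> ii'; subst i'; congr (_, _); exact: (lo_inj q0 c a c' a').
  move=> jj'; subst j'; congr (_, _).
  by apply: (lo_inj p0 (ltW c) b (ltW c') b').
have -> : (\sum_i \sum_j (0 < overlap p q i j)%R = #|A|)%N.
  by rewrite pair_bigA /= -sum1_card [RHS]big_mkcond.
have -> : (\sum_i (0 < p i)%R + \sum_j (0 < q j)%R = #|B|.+1)%N.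
  rewrite -sum1_card [in RHS]big_mkcond big_sumType /= (bigD1 j0)//= qj0 add1n addnS.
  congr (_ + _).+1; rewrite big_mkcond /=.
  by apply: eq_bigr => j _; rewrite inE; case: (j != j0).
rewrite ltnS -(card_in_imset finj); apply/subset_leq_card/fintype.subsetP => s.
case/imsetP => -[i j]; rewrite inE /= => /overlap_gt0[pi qj a b] ->.
rewrite /f /=; case: leP => c; rewrite inE //= qj andbT.
apply: contraTneq c => ->; rewrite loj0 -leNgt; exact: lo_ge0.
Qed.

End Shuffle.

(** The new members are the sets where a given overlap is positive. At each point at most (k + 1) +
    (l + 1) - 1 overlaps are positive. *)
Lemma has_cover_join (R : realType) (T : topologicalType) (d : T -> T -> R)
    (P Q S : set T -> Prop) k l : topology_metric d ->
  (forall A B C, P A -> Q B -> C `<=` A -> C `<=` B -> S C) ->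
  has_cover P k -> has_cover Q l -> has_cover S (k + l).
Proof.
move=> dm PQS [I [V [oV cV PV kV]]] [J [W [oW cW QW lW]]].
have [p [cp p0 pV p1]] := partition_of_unity dm oV cV.
have [q [cq q0 qW q1]] := partition_of_unity dm oW cW.
pose r (x : I * J) t := overlap (p^~ t) (q^~ t) x.1 x.2.
have rP x t : (0 < r x t)%R -> V x.1 t /\ W x.2 t.
  by move=> /overlap_gt0[/pV ? /qW ? _ _].
have cr x : continuous (r x).
  have clo (K : finType) (u : K -> T -> R) : (forall i, continuous (u i)) ->
      forall i, continuous (fun t => lo (u^~ t) i).
    by move=> cu i; apply: continuous_sum.
  have cP := clo _ _ cp x.1; have cQ := clo _ _ cq x.2.
  have cP' : continuous (fun t => lo (p^~ t) x.1 + p x.1 t)%R.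
    by move=> t; apply: cvgD; [exact: cP|exact: cp].
  have cQ' : continuous (fun t => lo (q^~ t) x.2 + q x.2 t)%R.
    by move=> t; apply: cvgD; [exact: cQ|exact: cq].
  move=> t; apply: cvgB; first exact: (min_fun_continuous cP' cQ').
  exact: (max_fun_continuous cP cQ).
exists (I * J)%type, (fun x => [set t | 0 < r x t]%R); split=> [x|t|x|t].
- by apply: (@open_comp _ _ (r x) [set u | 0 < u]%R); [move=> t _; exact: cr|exact: open_gt].
- have [i [j rij]] := overlap_ex (p0^~ t) (q0^~ t) (p1 t) (q1 t).
  by exists (i, j).
- by apply: (PQS _ _ _ (PV x.1) (QW x.2)) => t /rP[].
have inE' (K : finType) (u : K -> T -> R) (Z : K -> set T) :
    (forall i t, 0 < u i t <-> Z i t)%R -> forall i, (t \in Z i) = (0 < u i t)%R.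
  by move=> uZ i; apply/idP/idP; rewrite inE uZ.
have lt := overlap_card (p0^~ t) (q0^~ t) (q1 t).
have kp : (\sum_i (0 < p i t)%R <= k.+1)%N.
  by apply: leq_trans (kV t); apply: leq_sum => i _; rewrite (inE' _ _ _ pV).
have lq : (\sum_j (0 < q j t)%R <= l.+1)%N.
  by apply: leq_trans (lW t); apply: leq_sum => j _; rewrite (inE' _ _ _ qW).
rewrite pair_bigA /= in lt.
rewrite (eq_bigr (fun x => nat_of_bool (0 < r x t)%R)); last first.
  by move=> x _; congr nat_of_bool; apply/idP/idP; rewrite inE.
rewrite -ltnS; apply: leq_trans lt _; apply: leq_trans (leq_add kp lq) _.
by rewrite addSn addnS.
Qed.

(** * Uniform estimates from compactness *)

Section Compactness.
Local Open Scope ring_scope.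
Context {R : realType}.

(** On the compact set where [h] is at least [e], [f] attains a minimum, which is positive since [h]
    is at most 0 at the zeros of [f]. This minimum is δ. *)
Lemma compact_modulus (T : topologicalType) (f h : T -> R) : compact [set: T] ->
  continuous f -> continuous h -> (forall x, 0 <= f x) ->
  (forall x, f x = 0 -> h x <= 0) ->
  forall e, 0 < e -> exists2 δ, 0 < δ & forall x, f x < δ -> h x < e.
Proof.
move=> cT cf ch f0 fh e e0; pose A := [set x | e <= h x].
have cA : compact A.
  apply: (subclosed_compact _ cT) => //.
  by apply: (@preimage_closed _ _ h [set u | e <= u]);
    [move=> x _; exact: ch|exact: closed_ge].
have [A0|/set0P nA0] := eqVneq A set0.
  exists 1 => // x _; rewrite ltNge; apply/negP => ex.
  by have : A x by []; rewrite A0.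
have [c] := compact_EVT_min nA0 cA (continuous_subspaceT cf).
rewrite inE => Ac cmin; exists (f c) => [|x fx].
  rewrite lt_neqAle f0 andbT eq_sym; apply/eqP => /fh.
  by rewrite leNgt (lt_le_trans e0 Ac).
rewrite ltNge; apply/negP => ex; move: fx; rewrite ltNge cmin//.
by rewrite inE.
Qed.

Lemma lebesgue_number (T : topologicalType) (d : T -> T -> R) (U : {fset set T}) :
  topology_metric d -> compact [set: T] -> fin_open_cover U ->
  exists2 δ, 0 < δ & forall x, exists2 A, A \in U & forall y, d x y < δ -> A y.
Proof.
move=> dm cT [oU cU]; pose s x := \sum_(A <- U) gap d A x.
have cs : continuous s by apply: continuous_sum => A _; exact: continuous_gap.
have s0 x : 0 <= s x by apply: sumr_ge0 => A _; exact: gap_ge0.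
have sn0 x : s x = 0 -> (1 : R) <= 0.
  have [A AU Ax] := cU x; rewrite /s (big_fsetD1 A)//= => /eqP.
  rewrite gt_eqF// ltr_wpDr ?sumr_ge0//; first by move=> *; exact: gap_ge0.
  exact/(gap_gt0 dm)/Ax/oU.
(* With the constant function 1 for [h], the modulus becomes a positive lower bound for [s]. *)
have [δ δ0 Hδ] := compact_modulus cT cs (@cst_continuous T R 1) s0 sn0 ltr01.
exists (δ / #|` U|.+1%:R); first by rewrite divr_gt0.
move=> x; apply: contrapT => nA; have : s x < δ; last by move/Hδ; rewrite ltxx.
apply: (@le_lt_trans _ _ (\sum_(A <- U) δ / #|` U|.+1%:R)).
  rewrite /s big_seq [leRHS]big_seq; apply: ler_sum => A AU.
  rewrite leNgt; apply/negP => lt; apply: nA; exists A => // y /lt_trans -/(_ _ lt).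
  exact: lt_gap.
rewrite big_tnth sumr_const card_ord -[ltLHS]mulr_natr mulrAC.
by rewrite ltr_pdivrMr// ltr_pM2l// ltr_nat.
Qed.

Lemma fine_cover (T : topologicalType) (d : T -> T -> R) (δ : R) :
  topology_metric d -> [set: T] !=set0 -> compact [set: T] -> 0 < δ ->
  exists2 U : {fset set T}, fin_open_cover U &
    forall A x y, A \in U -> A x -> A y -> d x y < δ.
Proof.
move=> dm [x0 _] cT δ0.
(* The covering form of compactness is stated for pointed spaces; [x0] serves as the point. *)
pose T' : ptopologicalType :=
  HB.pack (Topological.sort T) (isPointed.Build (Topological.sort T) x0).
have : @compact T' [set: T'] by exact: cT.
rewrite compact_cover => cov.
pose b (x : T) : set T := interior [set y | d x y < δ / 2].
have δ20 : 0 < δ / 2 by rewrite divr_gt0.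
have [|x _|D _ Dcov] := cov T setT b.
- by move=> x _; exact: open_interior.
- by exists x => //; exact: near_tm.
exists [fset b x | x in D]%fset; first split=> [A|x].
- by move=> /imfsetP[x _ ->]; exact: open_interior.
- have [y /= yD bx] := Dcov x I; exists (b y) => //.
  by apply/imfsetP; exists y.
move=> A x y /imfsetP[z _ ->] /interior_subset /= zx /interior_subset /= zy.
have := tm_triangle dm x z y; rewrite (tm_sym dm x z); lra.
Qed.

End Compactness.

(** * The limit defining mean dimension, and Følner sequences *)

Section MeanDimensionLimit.
Local Open Scope ring_scope.
Context {R : realType} {Γ : groupType} {T : topologicalType} (act : Γ -> T -> T).
Hypothesis dyn : dynamical_system R act.

Lemma dynamical_system_metric : exists d : T -> T -> R, topology_metric d.
Proof. by have [d [? ? ? ?]] := ds_metrizable dyn; exists d. Qed.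

(** Subadditivity is [has_cover_join]. For invariance, a cover fine enough for [A] is pulled back
    along [act c], since [k * c] acts by [c] and then by [k]. *)
Lemma cover_D_sai (U : {fset set T}) : fin_open_cover U ->
  subadditive_invariant (fun F => (cover_D (cover_dyn act U F))%:R : R).
Proof.
move=> cU; have cact := ds_continuous dyn; have [d dm] := dynamical_system_metric.
have cD F := fin_open_cover_dyn F cact cU.
split=> [A||A B|A c]; rewrite ?ler0n//.
- suff : (cover_D (cover_dyn act U fset0) <= 0)%N by rewrite leqn0 => /eqP ->.
  apply/cover_D_leP => //; exists unit, (fun _ => setT); split=> [_|x|_|x].
  + exact: openT.
  + by exists tt.
  + by apply/under_cover_dyn => s; rewrite inE.
  + by rewrite big_const card_unit /= addn0 leq_b1.
- rewrite -natrD ler_nat; apply/(cover_D_leP _ (cD _)).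
  apply: (has_cover_join dm _ ((cover_D_leP _ (cD A)).1 (leqnn _))
    ((cover_D_leP _ (cD B)).1 (leqnn _))).
  move=> V W C /under_cover_dyn HV /under_cover_dyn HW CV CW.
  apply/under_cover_dyn => s; rewrite in_fsetU => /orP[/HV|/HW] [S SU sub].
    by exists S => // x /CV; exact: sub.
  by exists S => // x /CW; exact: sub.
- rewrite ler_nat; apply/(cover_D_leP _ (cD _)).
  apply: (has_cover_preimage (cact c) _ ((cover_D_leP _ (cD A)).1 (leqnn _))).
  move=> B /under_cover_dyn HB; apply/under_cover_dyn => s /rtranslP[k kA ->].
  have [S SU sub] := HB _ kA; exists S => // x /= /sub /=.
  by rewrite (ds_actM dyn).
Qed.

Lemma cover_D_limit (U : {fset set T}) : amenable R Γ -> fin_open_cover U ->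
  (cover_D (cover_dyn act U F))%:R / #|` F|%:R @[F --> folner_filter R Γ] -->
  lim (((cover_D (cover_dyn act U F))%:R / #|` F|%:R : R)
         @[F --> folner_filter R Γ]).
Proof.
move=> am cU; have PF := folner_filter_proper am.
have [l ll] := ornstein_weiss am (cover_D_sai cU).
by rewrite (cvg_lim _ ll).
Qed.

End MeanDimensionLimit.

(** The exits of a single [k] are counted by the symmetric difference, hence eventually at most δ|F
    n| / |K|; summing over [K] bounds the boundary by δ|F n|. *)
Lemma folner_sequence_cvg (R : realType) (Γ : groupType) (F : nat -> {fset Γ}) :
  folner_sequence R F -> F @ \oo --> folner_filter R Γ.
Proof.
move=> [F0 HF] S [[K δ] [/= K0 δ0] HS].
have cK : (0 < #|` K|%:R :> R)%R by rewrite ltr0n cardfs_gt0.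
pose E k := [set n | (exits k (F n))%:R <= δ / #|` K|%:R * #|` F n|%:R]%R.
have HE : \forall n \near \oo, (\bigcap_(k in [set` K]) E k) n.
  apply: filter_bigI => k _.
  have e0 : (0 < δ / #|` K|%:R)%R by rewrite divr_gt0.
  have /cvgrPdist_lt/(_ _ e0) := HF k; apply: filterS => n.
  rewrite sub0r normrN /E /= => /ltW H.
  have cF : (0 < #|` F n|%:R :> R)%R by rewrite ltr0n cardfs_gt0.
  rewrite -ler_pdivrMr//; apply: le_trans (le_trans (ler_norm _) H).
  rewrite ler_pM2r ?invr_gt0// ler_nat /exits.
  rewrite -(card_ltransl k); apply: fsubset_leq_card; apply/fsubsetP => x.
  move=> /imfsetP[/= t]; rewrite !inE /= => /andP[tF ktF] ->.
  by rewrite ktF /=; apply/orP; left; apply/imfsetP; exists t.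
apply: filterS HE => n HE; apply: HS; apply/almost_invP => //.
apply: (@le_trans _ _ (\sum_(k <- K) (exits k (F n))%:R)%R).
  rewrite -natr_sum ler_nat card_fset_sum.
  under [X in (_ <= X)%N]eq_bigr do rewrite /exits card_fset_sum.
  rewrite exchange_big /=; apply: leq_sum => t _.
  case: rtransl_subP => // /existsNP[k /not_implyP[kK /negP kF]].
  by rewrite (big_fsetD1 k)//= kF.
apply: (@le_trans _ _ (\sum_(k <- K) (δ / #|` K|%:R * #|` F n|%:R))%R).
  by rewrite big_seq [leRHS]big_seq; apply: ler_sum => k kK; exact: HE.
by rewrite big_tnth sumr_const card_ord -[leLHS]mulr_natr mulrAC divfK ?gt_eqF.
Qed.

(** * Comparing the fibres with G *)

Section Fibres.
Context {R : realType} {Γ : groupType} {X G : topologicalType}.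
Context {actX : Γ -> X -> X} {actG : Γ -> G -> G} {m : X -> G -> X}.
Context {dX : X -> X -> R} {dG : G -> G -> R}.
Hypotheses (dsX : dynamical_system R actX) (dsG : dynamical_system R actG).
Hypotheses (dmX : topology_metric dX) (dmG : topology_metric dG).
Hypothesis mC : continuous (fun p : X * G => m p.1 p.2).
Hypothesis mI : forall x g g', m x g = m x g' <-> g = g'.
Hypothesis mE : forall t x g, actX t (m x g) = m (actX t x) (actG t g).

Let T : topologicalType := (X * (G * G))%type.

Let cT : compact [set: T].
Proof.
rewrite -setXTT; apply: compact_setX; first exact: (ds_compact dsX).
by rewrite -setXTT; apply: compact_setX; exact: (ds_compact dsG).
Qed.

Let cdG : continuous (fun p : T => dG p.2.1 p.2.2).
Proof.
move=> p; apply: (@continuous_comp _ _ _ (fun p : T => p.2) (fun q => dG q.1 q.2)).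
  exact: cvg_snd.
exact: continuous_tm.
Qed.

Let cdX : continuous (fun p : T => dX (m p.1 p.2.1) (m p.1 p.2.2)).
Proof.
have c1 : continuous (fun p : T => (p.1, p.2.1)).
  move=> p; apply: cvg_pair; first exact: cvg_fst.
  by apply: cvg_comp; [exact: cvg_snd|exact: cvg_fst].
have c2 : continuous (fun p : T => (p.1, p.2.2)).
  move=> p; apply: cvg_pair; first exact: cvg_fst.
  by apply: cvg_comp; exact: cvg_snd.
have c : continuous (fun p : T => (m p.1 p.2.1, m p.1 p.2.2)).
  move=> p; apply: cvg_pair.
    by apply: (@continuous_comp _ _ _ (fun p : T => (p.1, p.2.1)) (fun q => m q.1 q.2));
      [exact: c1|exact: mC].
  by apply: (@continuous_comp _ _ _ (fun p : T => (p.1, p.2.2)) (fun q => m q.1 q.2));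
    [exact: c2|exact: mC].
move=> p; apply: (@continuous_comp _ _ _ (fun p : T => (m p.1 p.2.1, m p.1 p.2.2))
  (fun q => dX q.1 q.2)); first exact: c.
exact: continuous_tm.
Qed.

(** Including the base point in the compact space [X * (G * G)] makes δ uniform in [x]. *)
Lemma fibre_modulus e : (0 < e)%R -> exists2 δ, (0 < δ)%R &
  forall x g g', (dG g g' < δ)%R -> (dX (m x g) (m x g') < e)%R.
Proof.
move=> e0; have [p|p /=|δ δ0 H] := compact_modulus cT cdG cdX _ _ e0.
- exact: tm_ge0.
- by move/(tm_eq0 dmG) => ->; rewrite tm_refl.
- by exists δ => // x g g' ?; exact: (H (x, (g, g'))).
Qed.

(** By injectivity of [m x] the distance in [X] vanishes only for g = g', so the two distances may
    exchange roles. *)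
Lemma fibre_inv_modulus e : (0 < e)%R -> exists2 δ, (0 < δ)%R &
  forall x g g', (dX (m x g) (m x g') < δ)%R -> (dG g g' < e)%R.
Proof.
move=> e0; have [p|p /=|δ δ0 H] := compact_modulus cT cdX cdG _ _ e0.
- exact: tm_ge0.
- by move/(tm_eq0 dmX)/mI => ->; rewrite tm_refl.
- by exists δ => // x g g' ?; exact: (H (x, (g, g'))).
Qed.

(** Members of [V] are so small that every [m x] keeps their images within a Lebesgue number of [U].
    One [V] must serve all [x], because the action moves the fibre. *)
Lemma cover_pullback (U : {fset set X}) : fin_open_cover U ->
  exists2 V : {fset set G}, fin_open_cover V &
  forall x B, B \in V -> exists2 A, A \in U & B `<=` m x @^-1` A.
Proof.
move=> cU; have [e e0 He] := lebesgue_number dmX (ds_compact dsX) cU.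
have [δ δ0 Hδ] := fibre_modulus e0.
have [V cV HV] := fine_cover dmG (ds_nonempty dsG) (ds_compact dsG) δ0.
exists V => // x B BV; have [B0|/set0P[g Bg]] := eqVneq B set0.
  by have [A AU _] := He x; exists A => //; rewrite B0.
have [A AU HA] := He (m x g); exists A => // g' Bg'.
exact/HA/Hδ/(HV B).
Qed.

Lemma cover_pushforward (V : {fset set G}) : fin_open_cover V ->
  exists2 U : {fset set X}, fin_open_cover U &
  forall x A, A \in U -> exists2 B, B \in V & m x @^-1` A `<=` B.
Proof.
move=> cV; have [e e0 He] := lebesgue_number dmG (ds_compact dsG) cV.
have [δ δ0 Hδ] := fibre_inv_modulus e0.
have [U cU HU] := fine_cover dmX (ds_nonempty dsX) (ds_compact dsX) δ0.
exists U => // x A AU; have [A0|/set0P[g Ag]] := eqVneq (m x @^-1` A) set0.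
  have [g _] := ds_nonempty dsG.
  by have [B BV _] := He g; exists B => //; rewrite A0.
have [B BV HB] := He g; exists B => // g' Ag'.
exact/HB/(Hδ x)/(HU A).
Qed.

Context (K : set X) (x : X).
Hypothesis KE : K = range (m x).

Let to_fibre_in g : m x g \in K. Proof. by rewrite KE inE; exists g. Qed.

Let to_fibre (g : G) : K := exist _ (m x g) (to_fibre_in g).

Let continuous_to_fibre : continuous to_fibre.
Proof.
apply: continuous_comp_initial => g.
apply: (@continuous_comp _ _ _ (fun g => (x, g)) (fun p => m p.1 p.2)); last exact: mC.
by apply: cvg_pair; [exact: cvg_cst|exact: cvg_id].
Qed.

Let of_fibre_ex (u : K) : exists g, m x g = set_val u.
Proof.
have KR : K `<=` range (m x) by rewrite KE.
by have [g _ gu] := KR _ (set_valP u); exists g.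
Qed.

Let of_fibre (u : K) : G := projT1 (cid (of_fibre_ex u)).

Let of_fibreE u : m x (of_fibre u) = set_val u.
Proof. exact: (projT2 (cid (of_fibre_ex u))). Qed.

Let continuous_of_fibre : continuous of_fibre.
Proof.
move=> u S; rewrite /= (tm_nbhs dmG) => -[e /= e0 eS].
have [δ δ0 Hδ] := fibre_inv_modulus e0.
have : \forall v \near u, (dX (set_val u) (set_val v) < δ)%R.
  exact: (@initial_continuous _ _ (@set_val X K) u _ (near_tm dmX _ δ0)).
by apply: filterS => v; rewrite -!of_fibreE => /Hδ/eS.
Qed.

(** Covers of [G] are carried to the fibre by [of_fibre]. The condition at [s] is checked on the
    fibre through [actX s x], where the comparison of [U] and [V] applies as well. *)
Lemma cover_D_fibre_le (U : {fset set X}) (V : {fset set G}) F :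
  fin_open_cover U -> fin_open_cover V ->
  (forall x B, B \in V -> exists2 A, A \in U & B `<=` m x @^-1` A) ->
  (cover_D (Defs.cover_restr K (cover_dyn actX U F)) <= cover_D (cover_dyn actG V F))%N.
Proof.
move=> cU cV VU; have cdV := fin_open_cover_dyn F (ds_continuous dsG) cV.
have cdU := fin_open_cover_dyn F (ds_continuous dsX) cU.
apply/cover_D_leP.
  by apply: fin_open_cover_preimage => //; exact: initial_continuous.
apply: (has_cover_preimage continuous_of_fibre _ ((cover_D_leP _ cdV).1 (leqnn _))).
move=> B /under_cover_dyn HB; apply/under_preimage.
have [C CU BC] : under_cover (cover_dyn actX U F) (m x @` B).
  apply/under_cover_dyn => s /HB[B' B'V BB'].
  have [A AU BA] := VU (actX s x) B' B'V; exists A => // _ [g Bg <-].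
  by rewrite /= mE; exact/BA/BB'.
by exists C => // u Bu; rewrite /= -of_fibreE; apply: BC; exists (of_fibre u).
Qed.

Lemma cover_D_fibre_ge (U : {fset set X}) (V : {fset set G}) F :
  fin_open_cover U -> fin_open_cover V ->
  (forall x A, A \in U -> exists2 B, B \in V & m x @^-1` A `<=` B) ->
  (cover_D (cover_dyn actG V F) <= cover_D (Defs.cover_restr K (cover_dyn actX U F)))%N.
Proof.
move=> cU cV UV; have cdV := fin_open_cover_dyn F (ds_continuous dsG) cV.
have cdU := fin_open_cover_dyn F (ds_continuous dsX) cU.
have cK : fin_open_cover (Defs.cover_restr K (cover_dyn actX U F)).
  by apply: fin_open_cover_preimage => //; exact: initial_continuous.
apply/(cover_D_leP _ cdV).
apply: (has_cover_preimage continuous_to_fibre _ ((cover_D_leP _ cK).1 (leqnn _))).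
move=> C /under_preimage CC'; apply/under_cover_dyn => s sF.
have [C' C'U sub] := CC'.
have [A AU CA] : exists2 A, A \in U & C' `<=` actX s @^-1` A.
  by apply/(under_cover_dyn actX U F C').1 => //; exists C'.
have [B BV AB] := UV (actX s x) A AU; exists B => // g Cg /=.
by apply: AB; rewrite /= -mE; exact/CA/(sub _ Cg).
Qed.

End Fibres.

(** * Equality of the two mean dimensions *)

Lemma le_limn_einf (R : realType) (u v : nat -> \bar R) :
  (forall n, u n <= v n)%E -> (limn_einf u <= limn_einf v)%E.
Proof.
move=> uv; rewrite !limn_einf_lim; apply: lee_lim; [exact: is_cvg_einfs..|].
apply: nearW => n; apply: le_ereal_inf_tmp => _ [k nk <-].
by apply: le_trans (uv k); apply: ereal_inf_lbound; exists k.
Qed.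

Theorem proposition2p17 (R : realType) (Γ : groupType) (F : nat -> {fset Γ})
    (X Y G : topologicalType)
    (actX : Γ -> X -> X) (actY : Γ -> Y -> Y) (actG : Γ -> G -> G)
    (π : X -> Y) :
  countable [set: Γ] ->
  amenable R Γ ->
  folner_sequence R F ->
  dynamical_system R actX ->
  dynamical_system R actY ->
  dynamical_system R actG ->
  factor_map actX actY π ->
  G_extension actX actG π ->
  forall y : Y, mdim R actG = mdim_subset R F actX (π @^-1` [set y]).
Proof.
move=> _ am fol dsX _ dsG [_ _ π_surj] [m [mC mfib mI mE]] y.
have [dX dmX] := dynamical_system_metric dsX; have [dG dmG] := dynamical_system_metric dsG.
have [x _ xy] : exists2 x, setT x & π x = y by exact: π_surj.
have KE : π @^-1` [set y] = range (m x) by rewrite -xy mfib.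
set K := π @^-1` [set y] in KE *.
(* Since the limit over invariant sets exists, the lower limit along the given Følner sequence has
   the same value. *)
have limF V : fin_open_cover V ->
  (lim (((cover_D (cover_dyn actG V F))%:R / #|` F|%:R : R)
            @[F --> folner_filter R Γ]))%:E =
  limn_einf (fun n => ((cover_D (cover_dyn actG V (F n)))%:R / #|` F n|%:R : R)%R%:E).
  move=> cV; have := cvg_comp _ _ (folner_sequence_cvg fol) (cover_D_limit dsG am cV).
  move=> cvF; apply/esym/(cvg_limn_einf_sup _).1.
  by apply: cvg_EFin => //; exact: nearW.
apply/eqP; rewrite eq_le; apply/andP; split; apply: ge_ereal_sup => _ [W cW <-].
  (* A cover of [G] is dominated by one of [X] for the first inequality, and a cover of [X] by one
     of [G] for the second. *)
  have [U cU HU] := cover_pushforward dsX dsG dmX dmG mC mI cW.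
  rewrite (limF W cW).
  apply: le_trans (ereal_sup_ubound _); last by exists U.
  apply: le_limn_einf => n; rewrite lee_fin ler_wpM2r// ler_nat.
  exact: (cover_D_fibre_ge dsX dsG mC mE KE _ cU cW HU).
have [V cV HV] := cover_pullback dsX dsG dmX dmG mC cW.
apply: le_trans (ereal_sup_ubound _); last by exists V.
rewrite /= limF//; apply: le_limn_einf => n; rewrite lee_fin ler_wpM2r// ler_nat.
exact: (cover_D_fibre_le dsX dsG dmX dmG mC mI mE KE _ cW cV HV).
Qed.
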